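(* Let $H_0,H_1$ be Hilbert spaces and let $C:\operatorname{dom}(C)\subseteq H_0\to H_1$ and $D:\operatorname{dom}(D)\subseteq H_0\to H_1$ be two densely defined closed linear operators such that $\operatorname{dom}(C)\cap\operatorname{dom}(D)$ is dense in $H_0$. Moreover, let $L_n\in L(H_1)$, $R_n\in L(H_0)$ be such that $R_n[\operatorname{dom}(C)\cap\operatorname{dom}(D)]\subseteq\operatorname{dom}(C)\cap\operatorname{dom}(D)$ and $[L_n,C+D,R_n]$ is continuous for each $n\in\mathbb{N}$. If $(C+D)^*L_n^*=(C^*+D^* )L_n^*$ for each $n\in\mathbb{N}$ and $$R_n^*\to1,\qquad L_n^*\to1,\qquad [L_n,C+D,R_n]^*\to0$$ strongly as $n\to\infty$, then $$\overline{C^*+D^*}=(C+D)^*.$$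
   Context: Hilbert spaces are real. The sum $C+D$ has domain $\operatorname{dom}(C)\cap\operatorname{dom}(D)$ (similarly for $C^*+D^*$), and products of operators have their natural domains. The transmutator is $[L,T,R]:=LT-TR$ with domain $\operatorname{dom}(T)$ (for $T:\operatorname{dom}(T)\subseteq H_0\to H_1$, bounded $L$ on $H_1$, bounded $R$ on $H_0$ with $R[\operatorname{dom}(T)]\subseteq\operatorname{dom}(T)$); ''continuous'' means bounded on its domain. *)

(* Defs.v *)
From HB Require Import structures.
From mathcomp Require Import all_boot all_order all_algebra.
From mathcomp Require Import all_classical all_reals all_analysis.

Set Implicit Arguments.
Unset Strict Implicit.
Unset Printing Implicit Defensive.

Import Order.TTheory GRing.Theory Num.Theory.
Import numFieldNormedType.Exports.

Local Open Scope classical_set_scope.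
Local Open Scope ring_scope.

HB.mixin Record NormedModule_hasInner (R : realType) T
    of NormedModule R T := {
  inner : {dot T for @idfun R};
  inner_norm : forall x : T, inner x x = `|x| ^+ 2
}.

(* Real Hilbert spaces; [theta = idfun] makes the form bilinear and symmetric. *)
#[short(type="hilbertType")]
HB.structure Definition Hilbert (R : realType) :=
  { T of NormedModule_hasInner R T & CompleteNormedModule R T }.

(* Possibly unbounded operators are identified with their graphs, so that
   equality of operators (domains included) is equality of sets.  The
   operations are defined for arbitrary relations in [U * V]. *)
Record linear_operator (R : realType) (U V : hilbertType R) := LinearOperator {
  graph :> set (U * V);
  graph0 : graph (0, 0);
  graph_linear : forall (a : R) (p q : U * V),
    graph p -> graph q -> graph (a *: p + q);
  graph_single_valued : forall x y y', graph (x, y) -> graph (x, y') -> y = y'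
}.

Section Operators.
Context {R : realType}.
Implicit Types U V W : hilbertType R.

Definition graph_of {U V} (f : U -> V) : set (U * V) :=
  [set p | p.2 = f p.1].

Definition dom {U V} (T : set (U * V)) : set U :=
  [set x | exists y, T (x, y)].

(* The value at [x], with junk value 0 outside the domain. *)
Definition app {U V} (T : set (U * V)) (x : U) : V :=
  xget 0 [set y | T (x, y)].

Definition op_add {U V} (S T : set (U * V)) : set (U * V) :=
  [set p | exists y z, [/\ S (p.1, y), T (p.1, z) & p.2 = y + z]].

Definition op_opp {U V} (T : set (U * V)) : set (U * V) :=
  [set p | T (p.1, - p.2)].

Definition op_comp {U V W} (S : set (V * W)) (T : set (U * V)) : set (U * W) :=
  [set p | exists y, T (p.1, y) /\ S (y, p.2)].

(* The graph of the Hilbert space adjoint when [T] is densely defined. *)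
Definition adjoint {U V} (T : set (U * V)) : set (V * U) :=
  [set q | forall x y, T (x, y) -> inner y q.1 = inner x q.2].

(* [L T - T R]; its domain is [dom T] as soon as [r] maps [dom T] into itself. *)
Definition transmutator {U V} (l : V -> V) (T : set (U * V)) (r : U -> U) :
    set (U * V) :=
  op_add (op_comp (graph_of l) T) (op_opp (op_comp T (graph_of r))).

Definition bounded_on_dom {U V} (T : set (U * V)) : Prop :=
  exists M : R, forall x y, T (x, y) -> `|y| <= M * `|x|.

(* For everywhere defined [T n]. *)
Definition strongly_cvg {U V} (T : nat -> set (U * V)) (f : U -> V) : Prop :=
  forall x, (fun n => app (T n) x) @ \oo --> f x.

End Operators.

(* Main.v *)
Require Import Defs.
From mathcomp Require Import all_boot all_order all_algebra.
From mathcomp Require Import all_classical all_reals all_analysis.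
From mathcomp Require Import ring lra.
Import Order.TTheory GRing.Theory Num.Theory.
Import numFieldNormedType.Exports.
Local Open Scope classical_set_scope.
Local Open Scope ring_scope.

(** Write [T] for [C + D], and a prime for adjoints.  The inclusion of the
    closure of [C' + D'] in [T'] holds because [T'] extends [C' + D'] and
    adjoints are closed.

    For the converse, a point [(y, z)] of the graph of [T'] is approximated by
    the points [(L_n' y, R_n' z + [L_n, T, R_n]' y)], which tend to [(y, z)]
    by the three strong limits.  They lie on [T'], because for [x] in [dom T]
      [<T x, L_n' y> = <L_n T x, y> = <T R_n x, y> + <[L_n, T, R_n] x, y>]
    and the first summand is [<R_n x, z> = <x, R_n' z>]; this is
    [adjoint_transmutator].  Since their first component is in the range of
    [L_n'], the hypothesis [T' L_n' = (C' + D') L_n'] puts them on [C' + D'].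

    The computation uses values of the adjoints of [L_n], [R_n] and of the
    transmutator, so these adjoints must be everywhere defined.  That is the
    Riesz representation theorem, in the form [adjoint_exists]: for a bounded
    linear relation [T] and a vector [y], the quadratic functional
    [|u|^2 - 2 <v, y>] on [(u, v)] in [T] is bounded below, and the first
    components of a minimising sequence converge to a value of [T'] at [y]. *)

(** * Inner products *)

Section InnerProduct.
Context {R : realType} {H : hilbertType R}.
Implicit Types x y z : H.

Lemma innerC x y : inner x y = inner y x.
Proof. by rewrite hermC expr0 mul1r. Qed.

Lemma innerDl x y z : inner (x + y) z = inner x z + inner y z.
Proof. by rewrite linearDl. Qed.

Lemma innerZl (a : R) x y : inner (a *: x) y = a * inner x y.
Proof. by rewrite linearZl. Qed.

Lemma innerDr x y z : inner x (y + z) = inner x y + inner x z.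
Proof. by rewrite innerC innerDl innerC (innerC z). Qed.

Lemma innerZr (a : R) x y : inner x (a *: y) = a * inner x y.
Proof. by rewrite innerC innerZl innerC. Qed.

Lemma innerNr x y : inner x (- y) = - inner x y.
Proof. by rewrite -scaleN1r innerZr mulN1r. Qed.

Lemma innerBl x y z : inner (x - y) z = inner x z - inner y z.
Proof. by rewrite innerDl (innerC (- y)) innerNr (innerC z). Qed.

Lemma innerBr x y z : inner x (y - z) = inner x y - inner x z.
Proof. by rewrite innerDr innerNr. Qed.

Lemma sqr_normDZ x y (t : R) :
  `|x + t *: y| ^+ 2 = `|x| ^+ 2 + 2 * t * inner x y + t ^+ 2 * `|y| ^+ 2.
Proof.
rewrite -!inner_norm !(innerDl, innerDr, innerZl, innerZr) (innerC y x).
by ring.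
Qed.

(** A nonnegative polynomial of degree at most 2 has nonpositive discriminant;
    at degree below 2 it is constant.  This serves both for the Cauchy-Schwarz
    inequality and for the first-order condition at an approximate minimiser. *)
Lemma discriminant_le (a b c : R) : 0 <= c ->
  (forall t, 0 <= a + 2 * t * b + t ^+ 2 * c) -> b ^+ 2 <= a * c.
Proof.
rewrite le_eqVlt => /orP[/eqP <-|c_gt0] poly_ge0.
  rewrite mulr0; have [->|b_neq0] := eqVneq b 0; first by rewrite expr0n.
  (* The polynomial is affine; this [t] is where it takes the value -1. *)
  have := poly_ge0 (- (a + 1) / (2 * b)).
  have -> : a + 2 * (- (a + 1) / (2 * b)) * b + (- (a + 1) / (2 * b)) ^+ 2 * 0
    = - 1 by field.
  by lra.
(* [- b / c] is the minimum point of the parabola. *)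
have := poly_ge0 (- b / c).
have -> : a + 2 * (- b / c) * b + (- b / c) ^+ 2 * c = (a * c - b ^+ 2) / c.
  by field; rewrite gt_eqF.
by rewrite pmulr_lge0 ?invr_gt0// subr_ge0.
Qed.

Lemma cauchy_schwarz x y : `|inner x y| <= `|x| * `|y|.
Proof.
rewrite -ler_sqr ?nnegrE ?mulr_ge0// real_normK ?num_real// exprMn.
apply: discriminant_le => [|t]; first exact: sqr_ge0.
by rewrite -sqr_normDZ sqr_ge0.
Qed.

Lemma innerl_continuous y : continuous (fun x => inner x y).
Proof.
move=> x; apply/cvgrPdist_le => e e_gt0.
have y1_gt0 : 0 < `|y| + 1 by rewrite ltr_wpDl.
near=> z; rewrite -innerBl (le_trans (cauchy_schwarz _ _))//.
have xz : `|x - z| <= e / (`|y| + 1).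
  by near: z; apply: cvgr_dist_le; rewrite ?divr_gt0//; exact: cvg_id.
rewrite (le_trans (ler_wpM2r _ xz))// mulrAC ler_pdivrMr// ler_pM2l//.
by rewrite lerDl.
Unshelve. all: by end_near. Qed.

Lemma innerr_continuous x : continuous (fun y => inner x y).
Proof.
rewrite (_ : (fun y => inner x y) = fun y => inner y x).
  exact: innerl_continuous.
by apply/funext => y; rewrite innerC.
Qed.

Lemma inner_injr x y : (forall z, inner z x = inner z y) -> x = y.
Proof.
move=> xy; apply/eqP; rewrite -subr_eq0 -normr_eq0 -sqrf_eq0 -inner_norm.
by rewrite innerBr xy subrr.
Qed.

End InnerProduct.

(** * Existence of adjoints of bounded relations *)

(** Linearity is a property of graphs here, so that sums and products of
    operators with their natural domains are covered. *)
Definition linear_relation {R : realType} {U V : hilbertType R}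
    (T : set (U * V)) : Prop :=
  T (0, 0) /\ forall (a : R) (p q : U * V), T p -> T q -> T (a *: p + q).

Section BoundedRelation.
Context {R : realType} {U V : hilbertType R}.
Variables (T : set (U * V)) (y : V).
Hypotheses (T_linear : linear_relation T) (T_bounded : bounded_on_dom T).

(** For the functional [phi u = <v, y>], where [(u, v)] is in [T], this is the
    Dirichlet energy [|u|^2 - 2 phi u] of the Riesz representation theorem. *)
Let energy (p : U * V) : R := `|p.1| ^+ 2 - 2 * inner p.2 y.

Let energyDZ p q t : energy (p + t *: q) =
  energy p + 2 * t * (inner p.1 q.1 - inner q.2 y) + t ^+ 2 * `|q.1| ^+ 2.
Proof.
by rewrite /energy /= sqr_normDZ innerDl innerZl; ring.
Qed.

Let has_inf_energy : has_inf (energy @` T).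
Proof.
have [[T00 _] [M TM]] := (T_linear, T_bounded).
split; first by exists (energy (0, 0)), (0, 0).
exists (- (M * `|y|) ^+ 2) => _ [[u v] Tuv <-]; rewrite /energy/=.
have vy : inner v y <= M * `|u| * `|y|.
  rewrite (le_trans (ler_norm _))// (le_trans (cauchy_schwarz _ _))//.
  by rewrite ler_wpM2r// TM.
(* Complete the square in [|u|^2 - 2 M |y| |u|]. *)
have := sqr_ge0 (`|u| - M * `|y|); nra.
Qed.

(** At a point whose energy is within [e ^+ 2] of the infimum, moving in the
    direction [q] cannot lower the energy by more than [e ^+ 2]; the
    discriminant of this condition bounds the derivative in direction [q]. *)
Lemma almost_adjoint (e : R) : 0 < e -> exists2 p : U * V, T p &
  forall q, T q -> `|inner p.1 q.1 - inner q.2 y| <= e * `|q.1|.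
Proof.
move=> e_gt0; have e2_gt0 : 0 < e ^+ 2 by rewrite exprn_gt0.
have [_ [p Tp <-] Ep] := inf_adherent e2_gt0 has_inf_energy.
exists p => // q Tq.
rewrite -ler_sqr ?nnegrE ?mulr_ge0 ?(ltW e_gt0)// real_normK ?num_real// exprMn.
apply: discriminant_le => [|t]; first exact: sqr_ge0.
have Tpq : T (p + t *: q) by rewrite addrC; apply: T_linear.2.
have : inf (energy @` T) <= energy (p + t *: q).
  by apply: ge_inf; [exact: has_inf_energy.2 | exists (p + t *: q)].
rewrite energyDZ; lra.
Qed.

(** The first components of the [almost_adjoint] pairs form a Cauchy sequence,
    as one sees by testing two of these pairs against their own difference; in
    the limit the bound of [almost_adjoint] becomes the equation of the
    adjoint. *)
Lemma adjoint_exists : exists z, adjoint T (y, z).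
Proof.
have /choice[p pP] : forall n : nat, exists p : U * V, T p /\
    forall q, T q -> `|inner p.1 q.1 - inner q.2 y| <= n.+1%:R^-1 * `|q.1|.
  by move=> n; have [|p] := @almost_adjoint n.+1%:R^-1; [|exists p].
pose x n := (p n).1.
have x_dist m n : `|x m - x n| <= m.+1%:R^-1 + n.+1%:R^-1.
  have [->|mn] := eqVneq (x m - x n) 0; first by rewrite normr0 addr_ge0.
  have Tmn : T (p m - p n).
    rewrite -scaleN1r addrC; apply: T_linear.2; [exact: (pP n).1|].
    exact: (pP m).1.
  have near_mn k : `|inner (x k) (x m - x n) - inner (p m - p n).2 y| <=
      k.+1%:R^-1 * `|x m - x n| by exact: (pP k).2 _ Tmn.
  rewrite -(@ler_pM2r _ `|x m - x n|) ?normr_gt0// -expr2 -inner_norm.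
  rewrite innerBl mulrDl.
  move: (near_mn m) (near_mn n); rewrite !ler_norml.
  move=> /andP[_ m_le] /andP[n_ge _].
  by have := lerB m_le n_ge; rewrite opprB addrA subrK opprK.
have /cvg_ex[/= z xz] : cvg (x @ \oo).
  apply: cauchy_cvg; apply: cauchy_exP => e e_gt0.
  have e2_gt0 : 0 < e / 2 by rewrite divr_gt0.
  have [N _ NP] := near_infty_natSinv_lt (PosNum e2_gt0).
  exists (x N); suff : \forall n \near \oo, ball (x N) e (x n) by [].
  near=> n; suff: `|x N - x n| < e by rewrite -ball_normE.
  apply: le_lt_trans (x_dist _ _) _.
  rewrite (splitr e) ltrD//; first exact: (NP N (leqnn N)).
  by apply: NP; near: n; exact: nbhs_infty_ge.
have harmonic_cst (c : R) : n.+1%:R^-1 * c @[n --> \oo] --> 0.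
  by rewrite -[0](mul0r c); apply: cvgMr_tmp; exact: cvg_harmonic.
exists z => u v Tuv /=; rewrite [RHS]innerC.
have xu_z : inner (x n) u @[n --> \oo] --> inner z u.
  exact: continuous_cvg (innerl_continuous u z) xz.
rewrite -(cvg_lim (@Rhausdorff R) xu_z); apply/esym/cvg_lim => //.
apply/subr_cvg0; apply/norm_cvg0P.
apply: squeeze_cvgr (cvg_cst 0) (harmonic_cst `|u|).
by near=> n; apply/andP; split; [exact: normr_ge0 | exact: (pP n).2 _ Tuv].
Unshelve. all: by end_near. Qed.

End BoundedRelation.

(** * Linearity of sums, products and transmutators *)

Section RelationAlgebra.
Context {R : realType} {U V W : hilbertType R}.

Lemma linear_operator_relation (T : linear_operator U V) : linear_relation T.
Proof. by split; [exact: graph0 | exact: graph_linear]. Qed.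

Lemma linear_relation_graph_of (f : {linear U -> V}) :
  linear_relation (graph_of f).
Proof.
split=> [|a [u v] [u' v'] fu fu']; first by rewrite /graph_of/= linear0.
by move: fu fu'; rewrite /graph_of/= linearP => -> ->.
Qed.

Lemma linear_relation_add (S T : set (U * V)) :
  linear_relation S -> linear_relation T -> linear_relation (op_add S T).
Proof.
move=> [S0 S_linear] [T0 T_linear]; split.
  by exists 0, 0; split; rewrite ?addr0.
move=> a p q [y [z [Sy Tz p2]]] [y' [z' [Sy' Tz' q2]]].
exists (a *: y + y'), (a *: z + z'); split=> /=.
- exact: S_linear Sy Sy'.
- exact: T_linear Tz Tz'.
- by rewrite p2 q2 scalerDr addrACA.
Qed.

Lemma linear_relation_opp (T : set (U * V)) :
  linear_relation T -> linear_relation (op_opp T).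
Proof.
move=> [T0 T_linear]; split; first by rewrite /op_opp/= oppr0.
move=> a p q Tp Tq; rewrite /op_opp/= opprD -scalerN.
exact: T_linear Tp Tq.
Qed.

Lemma linear_relation_comp (S : set (V * W)) (T : set (U * V)) :
  linear_relation S -> linear_relation T -> linear_relation (op_comp S T).
Proof.
move=> [S0 S_linear] [T0 T_linear]; split; first by exists 0.
move=> a p q [y [Ty Sy]] [y' [Ty' Sy']]; exists (a *: y + y'); split.
- exact: T_linear Ty Ty'.
- exact: S_linear Sy Sy'.
Qed.

End RelationAlgebra.

Lemma linear_relation_transmutator {R : realType} {U V : hilbertType R}
    (l : {linear V -> V}) (T : set (U * V)) (r : {linear U -> U}) :
  linear_relation T -> linear_relation (transmutator l T r).
Proof.
move=> T_linear; apply: linear_relation_add.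
  by apply: linear_relation_comp => //; exact: linear_relation_graph_of.
apply: linear_relation_opp; apply: linear_relation_comp => //.
exact: linear_relation_graph_of.
Qed.

(** * Adjoints *)

Section Adjoint.
Context {R : realType} {U V : hilbertType R}.
Implicit Types S T : set (U * V).

(** An adjoint is cut out by equations between continuous functions. *)
Lemma closed_adjoint T : closed (adjoint T).
Proof.
have -> : adjoint T =
    \bigcap_(p in T) [set q | inner p.2 q.1 - inner p.1 q.2 = 0].
  apply/seteqP; split=> [q Tq [x y] Txy /=|q Tq x y Txy].
    by rewrite (Tq _ _ Txy) subrr.
  by apply/eqP; rewrite -subr_eq0; apply/eqP; exact: (Tq (x, y)).
apply: closed_bigI => -[x y] _.
apply: (@preimage_closed _ _
  (fun q : V * U => inner y q.1 - inner x q.2) [set 0]); last exact: closed_eq.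
move=> q _; apply: cvgB.
  by apply: continuous_comp; [exact: cvg_fst | exact: innerr_continuous].
by apply: continuous_comp; [exact: cvg_snd | exact: innerr_continuous].
Qed.

Lemma add_adjoint_sub S T :
  op_add (adjoint S) (adjoint T) `<=` adjoint (op_add S T).
Proof.
move=> q [w [w' [Sw Tw' q2]]] x y [v [v' [/= Sv Tv' ->]]].
by rewrite q2 innerDl (Sw _ _ Sv) (Tw' _ _ Tv') innerDr.
Qed.

Lemma bounded_graph_of (f : {linear U -> V}) :
  continuous f -> bounded_on_dom (graph_of f).
Proof.
move=> /linear_bounded_continuous/linear_boundedP[M [_ fM]].
by exists (M + 1) => x y fxy; rewrite (fxy : y = f x); apply: fM; rewrite ltrDl.
Qed.

(** The junk value of [app] never occurs for the adjoint of a bounded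
    relation. *)
Lemma adjoint_app T y : linear_relation T -> bounded_on_dom T ->
  adjoint T (y, app (adjoint T) y).
Proof.
move=> T_linear T_bounded.
have [z Tz] := adjoint_exists T y T_linear T_bounded.
exact: (@xgetI _ 0 [set w | adjoint T (y, w)] z).
Qed.

Lemma adjoint_graph_of_unique (f : U -> V) y z z' :
  adjoint (graph_of f) (y, z) -> adjoint (graph_of f) (y, z') -> z = z'.
Proof.
move=> fz fz'; apply: inner_injr => x.
by rewrite -(fz x (f x)) // -(fz' x (f x)).
Qed.

(** Take adjoints in [l T = T r + [l, T, r]] and evaluate them at [y].  The
    stability of [dom T] under [r] makes the domain of the transmutator all of
    [dom T], which gives the identity for every [x] in [dom T]. *)
Lemma adjoint_transmutator (l : V -> V) T (r : U -> U) y y' z u v :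
    (forall x, dom T x -> dom T (r x)) ->
    adjoint (graph_of l) (y, y') -> adjoint T (y, z) ->
    adjoint (graph_of r) (z, u) -> adjoint (transmutator l T r) (y, v) ->
  adjoint T (y', u + v).
Proof.
move=> r_dom ly Tz rz Bv x w Txw /=.
have [w' Trx] : dom T (r x) by apply: r_dom; exists w.
have B : transmutator l T r (x, l w - w').
  exists (l w), (- w'); split=> //=; first by exists w.
  by exists (r x); rewrite /= opprK.
rewrite -(ly w (l w)) // innerDr -(rz x (r x)) //= -(Tz _ _ Trx) -(Bv _ _ B) /=.
by rewrite innerBl addrC subrK.
Qed.

End Adjoint.

Theorem theorem3p14 (R : realType) (H0 H1 : hilbertType R)
    (C D : linear_operator H0 H1)
    (C_dense : dense (dom C)) (C_closed : closed C)
    (D_dense : dense (dom D)) (D_closed : closed D)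
    (CD_dense : dense (dom C `&` dom D))
    (L : nat -> {linear H1 -> H1}) (Rn : nat -> {linear H0 -> H0})
    (L_continuous : forall n, continuous (L n))
    (Rn_continuous : forall n, continuous (Rn n))
    (Rn_dom : forall n, Rn n @` (dom C `&` dom D) `<=` dom C `&` dom D)
    (trans_bounded : forall n,
      bounded_on_dom (transmutator (L n) (op_add C D) (Rn n)))
    (adjoint_eq : forall n,
      op_comp (adjoint (op_add C D)) (adjoint (graph_of (L n))) =
      op_comp (op_add (adjoint C) (adjoint D)) (adjoint (graph_of (L n))))
    (Rn_cvg : strongly_cvg (fun n => adjoint (graph_of (Rn n))) idfun)
    (L_cvg : strongly_cvg (fun n => adjoint (graph_of (L n))) idfun)
    (trans_cvg : strongly_cvg
      (fun n => adjoint (transmutator (L n) (op_add C D) (Rn n)))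
      (fun=> 0)) :
  closure (op_add (adjoint C) (adjoint D)) = adjoint (op_add C D).
Proof.
set T := op_add C D.
have T_linear : linear_relation T.
  by apply: linear_relation_add; exact: linear_operator_relation.
have dom_T : dom T = dom C `&` dom D.
  apply/seteqP; split=> [x [w [v [v' [/= Cv Dv' _]]]]|x [[v Cv] [v' Dv']]].
    by split; [exists v | exists v'].
  by exists (v + v'), v, v'.
apply/seteqP; split.
  rewrite [X in _ `<=` X](closure_id _).1; last exact: closed_adjoint.
  exact/closure_subset/add_adjoint_sub.
move=> [y z] Tyz.
pose y_ n := app (adjoint (graph_of (L n))) y.
pose u_ n := app (adjoint (graph_of (Rn n))) z.
pose v_ n := app (adjoint (transmutator (L n) T (Rn n))) y.
have L_y n : adjoint (graph_of (L n)) (y, y_ n).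
  by apply: adjoint_app (bounded_graph_of _ (L_continuous n));
    exact: linear_relation_graph_of.
have R_z n : adjoint (graph_of (Rn n)) (z, u_ n).
  by apply: adjoint_app (bounded_graph_of _ (Rn_continuous n));
    exact: linear_relation_graph_of.
have B_y n : adjoint (transmutator (L n) T (Rn n)) (y, v_ n).
  by apply: adjoint_app (trans_bounded n); exact: linear_relation_transmutator.
have CD_y n : op_add (adjoint C) (adjoint D) (y_ n, u_ n + v_ n).
  have Rn_T x : dom T x -> dom T (Rn n x).
    by rewrite dom_T => CDx; apply: (Rn_dom n); exists x.
  have : op_comp (adjoint T) (adjoint (graph_of (L n))) (y, u_ n + v_ n).
    exists (y_ n); split=> //.
    exact: adjoint_transmutator _ _ _ _ _ _ _ _ Rn_T
      (L_y n) Tyz (R_z n) (B_y n).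
  rewrite adjoint_eq => -[y' [L_y' CD_y']].
  by rewrite (adjoint_graph_of_unique _ _ _ _ (L_y n) L_y').
have uv_cvg : u_ n + v_ n @[n --> \oo] --> z.
  by rewrite -[z]addr0; exact: cvgD (Rn_cvg z) (trans_cvg y).
have graph_cvg : (y_ n, u_ n + v_ n) @[n --> \oo] --> (y, z).
  exact: cvg_pair (L_cvg y) uv_cvg.
apply: closed_cvg graph_cvg; first exact: closed_closure.
by apply: nearW => n; exact: subset_closure.
Qed.
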